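(* Let $G$, $\Theta$, $\mathcal H$, $\{\rho_\theta\}$, $\overline{\mathcal Q}=\{\bar\rho_\eta:\eta\in\Theta/G\}$, $\mathcal A_G$, and the finite block decomposition $\mathcal H=\bigoplus_{z\in\mathsf Z}\mathcal H_z$ with central projections $\Pi_z$ be as described in the context, and put $p_\eta(z):=\operatorname{Tr}(\bar\rho_\eta\Pi_z)$. Suppose $\mathcal H$ is finite dimensional, and suppose that whenever $a:\mathsf Z\to\mathbb R$ satisfies $\sum_{z\in\mathsf Z}p_\eta(z)a(z)=0$ for every $\eta\in\Theta/G$, one has $a(z)=0$ for every $z\in\mathsf Z$. Then the following are equivalent: (i) there exist density operators $\tau_z$ on $\mathcal H_z$ ($z\in\mathsf Z$), independent of $\eta$, such that $\bar\rho_\eta=\bigoplus_{z\in\mathsf Z}p_\eta(z)\tau_z$ for every $\eta\in\Theta/G$; (ii) the block-label measurement $M^\star(\{z\})=\Pi_z$, $z\in\mathsf Z$, is quantum-to-classically sufficient for $\overline{\mathcal Q}$ relative to all $G$-invariant POVMs.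
   Context: **Symmetric model.** $G$ is a compact Hausdorff group with normalized Haar measure $dg$, acting measurably on a parameter space $\Theta$; $g\mapsto U_g$ is a strongly continuous unitary representation of $G$ on a separable complex Hilbert space $\mathcal H$; $\{\rho_\theta:\theta\in\Theta\}$ is a family of density operators on $\mathcal H$ with $\rho_{g\theta}=U_g\rho_\theta U_g^\dagger$ for all $g,\theta$. $\Theta/G$ is the orbit space and $\pi:\Theta\to\Theta/G$ the quotient map. The orbit-averaged state is $\bar\rho_\eta:=\int_G U_g\rho_\theta U_g^\dagger\,dg$ for any $\theta$ with $\pi(\theta)=\eta$; it does not depend on the choice of $\theta$. **Blocks.** $\mathcal A_G:=\{A\in\mathcal L(\mathcal H):[A,U_g]=0\ \forall g\in G\}$, where $\mathcal L(\mathcal H)$ denotes the bounded operators. $\mathsf Z$ is a finite set and $\mathcal H=\bigoplus_{z\in\mathsf Z}\mathcal H_z$ is an orthogonal decomposition into nonzero subspaces whose orthogonal projections $\Pi_z$ are central in $\mathcal A_G$. **POVMs and sufficiency.** A POVM $M$ on $\mathcal H$ with outcome space $(\mathsf Y,\mathcal Y)$ is a map from $\mathcal Y$ to positive bounded operators that is countably additive in the weak operator topology, with $M(\mathsf Y)=I$; outcome spaces are standard Borel. $M$ is $G$-invariant if $U_g^\dagger M(B)U_g=M(B)$ for all $g$ and $B$. For a family of states $\mathcal Q=\{\sigma_\eta\}$, put $P^M_\eta(B):=\operatorname{Tr}[\sigma_\eta M(B)]$. A measurement $M^\star$ in a class $\mathfrak M$ of POVMs is *quantum-to-classically sufficient*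 for $\mathcal Q$ relative to $\mathfrak M$ if for every $N\in\mathfrak M$ there is a Markov kernel $K_N$ (not depending on $\eta$) from the outcome space of $M^\star$ to that of $N$ with $P^N_\eta(B)=\int K_N(x,B)\,P^{M^\star}_\eta(dx)$ for all $\eta$ and all measurable $B$. *)

(* Defs.v *)
From HB Require Import structures.
From mathcomp Require Import all_boot all_order all_algebra.
From mathcomp Require Import generic_quotient complex.
From mathcomp Require Import all_classical all_reals all_analysis.

Set Implicit Arguments.
Unset Strict Implicit.
Unset Printing Implicit Defensive.

Import Order.TTheory GRing.Theory Num.Theory.
Import numFieldNormedType.Exports.

Local Open Scope classical_set_scope.
Local Open Scope sesquilinear_scope.
Local Open Scope complex_scope.
Local Open Scope quotient_scope.
Local Open Scope ring_scope.

(* The finite-dimensional complex Hilbert space is C^n, realised as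
   'cV[R[i]]_n with inner product <u, v> = (u ^t* *m v) 0 0 (linear in v);
   its bounded operators are the matrices 'M[R[i]]_n, and A^dagger is A ^t*.
   R[i]^o is R[i] with its norm topology. *)

HB.mixin Record isTopologicalGroup G
    of Group G & PointedTopological G := {
  mulg_continuous : continuous (fun gh : G * G => (gh.1 * gh.2)%g) ;
  invg_continuous : continuous (fun g : G => (g^-1)%g) }.

(* PointedTopological only provides the default element that the library
   requires of every measurable type. *)
#[short(type="topGroupType")]
HB.structure Definition TopologicalGroup :=
  {G of Group G & PointedTopological G & isTopologicalGroup G}.

Notation borel T := (g_sigma_algebraType (@open T)).

(* On a compact Hausdorff group, Haar measure is unique among the *regular*
   left-invariant Borel probabilities; inner regularity does not come for free
   when G is not metrizable. *)
Definition normalized_haar (R : realType) (G : topGroupType)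
    (mu : probability (borel G) R) : Prop :=
  (forall (g : G) (B : set (borel G)), measurable B ->
     mu ((fun h : G => (g * h)%g) @^-1` B) = mu B) /\
  (forall B : set (borel G), measurable B ->
     mu B = ereal_sup [set mu K | K in
              [set K : set G | [/\ compact K, measurable (K : set (borel G))
                                 & K `<=` B]]]).

Record measurable_action (G : topGroupType) d (Theta : measurableType d) := {
  act_fun :> G -> Theta -> Theta ;
  act_one : forall theta, act_fun 1%g theta = theta ;
  act_mul : forall g h theta,
    act_fun (g * h)%g theta = act_fun g (act_fun h theta) ;
  act_measurable : measurable_fun [set: borel G * Theta]
    (fun gt : borel G * Theta => act_fun gt.1 gt.2) }.

Definition orbit_rel (G : topGroupType) d (Theta : measurableType d)
    (act : measurable_action G Theta) : rel Theta :=
  fun theta theta' => `[< exists g, theta' = act g theta >].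

Lemma orbit_rel_equiv (G : topGroupType) d (Theta : measurableType d)
    (act : measurable_action G Theta) : equiv_class_of (orbit_rel act).
Proof.
split.
- by move=> t; apply/asboolP; exists 1%g; rewrite act_one.
- have sym t t' : orbit_rel act t t' -> orbit_rel act t' t.
    move=> /asboolP[g ->]; apply/asboolP; exists (g^-1)%g.
    by rewrite -act_mul mulVg act_one.
  by move=> t t'; apply/idP/idP => /sym.
- move=> t' t t'' /asboolP[g ->] /asboolP[h ->]; apply/asboolP.
  by exists (h * g)%g; rewrite act_mul.
Qed.

Canonical orbit_equiv (G : topGroupType) d (Theta : measurableType d)
    (act : measurable_action G Theta) : equiv_rel Theta :=
  EquivRelPack (orbit_rel_equiv act).

Definition orbit_space (G : topGroupType) d (Theta : measurableType d)
    (act : measurable_action G Theta) : Type :=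
  {eq_quot (orbit_equiv act)}.

(* For complex z, 0 <= z says that z is real and nonnegative. *)
Definition psd (R : realType) n (A : 'M[R[i]]_n) : Prop :=
  forall v : 'cV[R[i]]_n, 0 <= (v ^t* *m A *m v) 0 0.

Definition density (R : realType) n (A : 'M[R[i]]_n) : Prop :=
  psd A /\ \tr A = 1.

Definition unitary_rep (R : realType) (G : topGroupType) n
    (U : G -> 'M[R[i]]_n) : Prop :=
  [/\ forall g, U g \is unitarymx,
      U 1%g = 1%:M,
      forall g h, U (g * h)%g = U g *m U h
    & forall v : 'cV[R[i]]_n,
        continuous (fun g => (U g *m v : 'cV[R[i]^o]_n))].

Definition covariant_family (R : realType) (G : topGroupType) d
    (Theta : measurableType d) (act : measurable_action G Theta) n
    (U : G -> 'M[R[i]]_n) (rho : Theta -> 'M[R[i]]_n) : Prop :=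
  (forall theta, density (rho theta)) /\
  (forall g theta, rho (act g theta) = U g *m rho theta *m (U g) ^t*).

Definition mx_integral (R : realType) d (T : measurableType d)
    (mu : {measure set T -> \bar R}) n (F : T -> 'M[R[i]]_n) : 'M[R[i]]_n :=
  \matrix_(i, j) ((\int[mu]_x complex.Re (F x i j))%R
               +i* (\int[mu]_x complex.Im (F x i j))%R).

(* The average over the orbit eta, computed at the representative
   repr eta : Theta of eta; by covariance and invariance of Haar measure it
   is the same for every theta with \pi theta = eta. *)
Definition orbit_average (R : realType) (G : topGroupType)
    (mu : probability (borel G) R) d (Theta : measurableType d)
    (act : measurable_action G Theta) n (U : G -> 'M[R[i]]_n)
    (rho : Theta -> 'M[R[i]]_n) (eta : orbit_space act) : 'M[R[i]]_n :=
  mx_integral mu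
    (fun g : borel G => U g *m rho (repr eta) *m (U g) ^t*).

Definition commutant (R : realType) (G : Type) n (U : G -> 'M[R[i]]_n) :
    set 'M[R[i]]_n :=
  [set A | forall g, A *m U g = U g *m A].

Definition central_in (R : realType) n (AG : set 'M[R[i]]_n)
    (P : 'M[R[i]]_n) : Prop :=
  AG P /\ forall A, AG A -> P *m A = A *m P.

Definition orthogonal_decomposition (R : realType) n (Z : finType)
    (H : Z -> {vspace 'cV[R[i]]_n}) : Prop :=
  [/\ forall z, H z != 0%VS,
      forall z z', z != z' -> forall u v, u \in H z -> v \in H z' ->
        (u ^t* *m v) 0 0 = 0
    & (\sum_(z : Z) H z)%VS = fullv].

Definition orthogonal_projection (R : realType) n
    (H : {vspace 'cV[R[i]]_n}) (P : 'M[R[i]]_n) : Prop :=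
  [/\ P ^t* = P, P *m P = P & forall v, (v \in H) = (P *m v == v)].

(* An operator on a subspace H of C^n is identified with its extension by 0 to
   the orthogonal complement of H.  For positive T this extension is
   characterised by its range lying in H, and block-diagonal direct sums
   become ordinary sums. *)
Definition density_on (R : realType) n (H : {vspace 'cV[R[i]]_n})
    (T : 'M[R[i]]_n) : Prop :=
  density T /\ forall v, T *m v \in H.

(* The trace is real when sigma and P are positive. *)
Definition born (R : realType) n (sigma P : 'M[R[i]]_n) : R :=
  complex.Re (\tr (sigma *m P)).

(* Borel isomorphic to a separable complete metric space; a metric is a
   Hausdorff pseudometric. *)
Definition standard_borel (R : realType) d (Y : measurableType d) : Prop :=
  exists S : completePseudoMetricType R,
    [/\ hausdorff_space S,
        exists2 D : set S, countable D & dense D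
      & exists (f : Y -> borel S) (g : borel S -> Y),
          [/\ cancel f g, cancel g f,
              measurable_fun setT f & measurable_fun setT g]].

Definition is_povm (R : realType) n d (Y : measurableType d)
    (M : set Y -> 'M[R[i]]_n) : Prop :=
  [/\ standard_borel R Y,
      forall B, measurable B -> psd (M B),
      M setT = 1%:M
    & forall B : (set Y)^nat, (forall k, measurable (B k)) ->
        trivIset setT B -> forall u v : 'cV[R[i]]_n,
        (fun m => \sum_(0 <= k < m) (u ^t* *m M (B k) *m v) 0 0 : R[i]^o)
          @ \oo --> ((u ^t* *m M (\bigcup_k B k) *m v) 0 0 : R[i]^o)].

Definition povm_class (R : realType) n :=
  forall d (Y : measurableType d), (set Y -> 'M[R[i]]_n) -> Prop.

Definition invariant_povms (R : realType) (G : Type) n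
    (U : G -> 'M[R[i]]_n) : povm_class R n :=
  fun d Y M => is_povm M /\
    forall g B, measurable B -> (U g) ^t* *m M B *m U g = M B.

Definition outcome_law (R : realType) n d (Y : measurableType d)
    (sigma : 'M[R[i]]_n) (M : set Y -> 'M[R[i]]_n) : set Y -> \bar R :=
  fun B => (born sigma (M B))%:E.

Definition qc_sufficient (R : realType) n (I : Type) (Q : I -> 'M[R[i]]_n)
    (MM : povm_class R n) d (X : measurableType d)
    (Mstar : set X -> 'M[R[i]]_n) : Prop :=
  MM d X Mstar /\
  forall d' (Y : measurableType d') (N : set Y -> 'M[R[i]]_n), MM d' Y N ->
    exists K : R.-pker X ~> Y, forall (eta : I) (B : set Y), measurable B ->
      (outcome_law (Q eta) N B
         = \int[outcome_law (Q eta) Mstar]_x K x B)%E.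

(* The finite set Z with the sigma-algebra of all its subsets; z0 only serves
   as the default element that the library requires of every measurable
   type. *)
Definition discrete_outcomes (Z : finType) (z0 : Z) : Type := Z.

HB.instance Definition _ (Z : finType) (z0 : Z) :=
  Finite.on (discrete_outcomes z0).
HB.instance Definition _ (Z : finType) (z0 : Z) :=
  isPointed.Build (discrete_outcomes z0) z0.
HB.instance Definition _ (Z : finType) (z0 : Z) :=
  @isMeasurable.Build default_measure_display (discrete_outcomes z0)
    discrete_measurable discrete_measurable0
    discrete_measurableC discrete_measurableU.

Definition block_label (R : realType) n (Z : finType) (z0 : Z)
    (Pi : Z -> 'M[R[i]]_n) : set (discrete_outcomes z0) -> 'M[R[i]]_n :=
  fun B => \sum_(z : Z | z \in (B : set Z)) Pi z.

(* Main.v *)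
Require Import Defs.
From HB Require Import structures.
From mathcomp Require Import all_boot all_order all_algebra.
From mathcomp Require Import generic_quotient complex.
From mathcomp Require Import all_classical all_reals all_analysis.

(* From (i) to (ii), the kernel z |-> Tr (tau_z N(B)) simulates every POVM N.
   Conversely, applied to the two-valued POVMs (E, 1 - E) with E an effect
   commuting with the representation, sufficiency gives weights a_E(z) >= 0 with
   Tr (rhobar_eta E) = sum_z p_eta(z) a_E(z).  As the vectors p_eta span R^Z,
   every functional E |-> sum_z v(z) a_E(z) is E |-> Tr (T E) for a real
   combination T of the rhobar_eta; tau_z is the T obtained from the basis
   vector v = delta_z.  Haar averages of rank one projections supply enough
   effects E to see that tau_z is positive, and that rhobar_eta and
   sum_z p_eta(z) tau_z, which both commute with the representation, agree. *)

Set Implicit Arguments.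
Unset Strict Implicit.
Unset Printing Implicit Defensive.

Import Order.TTheory GRing.Theory Num.Theory.
Import numFieldNormedType.Exports.

Local Open Scope classical_set_scope.
Local Open Scope complex_scope.
Local Open Scope ring_scope.

(** * Positive semidefinite matrices over a numerically closed field *)

Section PositiveMatrices.
Local Open Scope sesquilinear_scope.
Context {C : numClosedFieldType}.

(** At [C := R[i]] this is convertible to [psd], so the results of this section apply to [psd]
    directly. *)
Definition psdmx n (A : 'M[C]_n) : Prop :=
  forall v : 'cV[C]_n, 0 <= (v ^t* *m A *m v) 0 0.

Lemma trmxC_mul m n p (A : 'M[C]_(m, n)) (B : 'M[C]_(n, p)) :
  (A *m B) ^t* = B ^t* *m A ^t*.
Proof. by rewrite trmx_mul map_mxM. Qed.

Lemma trmxCD m n (A B : 'M[C]_(m, n)) : (A + B) ^t* = A ^t* + B ^t*.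
Proof. by rewrite linearD /= map_mxD. Qed.

Lemma trmxCN m n (A : 'M[C]_(m, n)) : (- A) ^t* = - A ^t*.
Proof. by rewrite linearN /= map_mxN. Qed.

Lemma trmxCZ m n (a : C) (A : 'M[C]_(m, n)) : (a *: A) ^t* = (a^*)%R *: A ^t*.
Proof. by rewrite linearZ /= map_mxZ. Qed.

Lemma form_trace n (A : 'M[C]_n) (u v : 'cV[C]_n) :
  (u ^t* *m A *m v) 0 0 = \tr (A *m (v *m u ^t*)).
Proof. by rewrite -trace_mx11 -mulmxA mxtrace_mulC mulmxA. Qed.

Lemma form_conj n (A : 'M[C]_n) (u v : 'cV[C]_n) :
  (u ^t* *m A ^t* *m v) 0 0 = (((v ^t* *m A *m u) 0 0)^*)%R.
Proof.
transitivity (((v ^t* *m A *m u) ^t*) 0 0); last by rewrite !mxE.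
by rewrite !trmxC_mul trmxCK mulmxA.
Qed.

(** Complex polarization, for arbitrary [A]: expanding at [u + v] makes the sesquilinear form
    antisymmetric in [u] and [v], replacing [v] by ['i *: v] makes it symmetric, hence it
    vanishes. *)
Lemma form_polarization n (A : 'M[C]_n) :
  (forall v : 'cV[C]_n, (v ^t* *m A *m v) 0 0 = 0) -> A = 0.
Proof.
move=> A0; pose b (u v : 'cV[C]_n) := \tr (u ^t* *m A *m v).
have b_diag v : b v v = 0 by rewrite /b trace_mx11.
have bD u v : b u v + b v u = 0.
  have := b_diag (u + v); rewrite /b trmxCD !mulmxDl !mulmxDr !mxtraceD.
  by rewrite -!/(b _ _) !b_diag add0r addr0 [in LHS]addrC.
have b0 u v : b u v = 0.
  have := bD u ('i *: v); rewrite /b trmxCZ -!scalemxAl -!scalemxAr !mxtraceZ.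
  rewrite conjCi mulNr -mulrBr => /eqP; rewrite mulf_eq0 (negPf (neq0Ci _)) /=.
  rewrite subr_eq0 => /eqP e; have := bD u v.
  by rewrite {2}/b -e -/(b u v) -mulr2n => /eqP; rewrite mulrn_eq0 /= => /eqP.
apply/matrixP=> i j; have := b0 (delta_mx i 0) (delta_mx j 0).
by rewrite /b trace_mx11 trmx_delta map_delta_mx -rowE -colE !mxE.
Qed.

(** The order on [C] forces the form of [A] to be real, so the form of [A ^t* - A] vanishes and
    polarization applies. *)
Lemma psd_trmxC n (A : 'M[C]_n) : psdmx A -> A ^t* = A.
Proof.
move=> Apsd; apply/eqP; rewrite -subr_eq0; apply/eqP/form_polarization => v.
rewrite mulmxBr mulmxBl mxE [X in _ + X]mxE form_conj.
by rewrite conj_Creal ?subrr// ger0_real.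
Qed.

Lemma trace_gram m n (X : 'M[C]_(m, n)) :
  \tr (X ^t* *m X) = \sum_i \sum_j `|X j i| ^+ 2.
Proof.
apply: eq_bigr => i _; rewrite mxE; apply: eq_bigr => j _.
by rewrite !mxE mulrC -normCK.
Qed.

Lemma trace_gram_ge0 m n (X : 'M[C]_(m, n)) : 0 <= \tr (X ^t* *m X).
Proof.
by rewrite trace_gram; do 2![apply: sumr_ge0 => ? _]; rewrite exprn_ge0.
Qed.

Lemma trace_gram_eq0 m n (X : 'M[C]_(m, n)) : \tr (X ^t* *m X) = 0 -> X = 0.
Proof.
rewrite trace_gram => X0; apply/matrixP => j i; rewrite mxE.
have col_ge0 k : 0 <= \sum_j `|X j k| ^+ 2.
  by apply: sumr_ge0 => ? _; rewrite exprn_ge0.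
move/eqP: X0; rewrite psumr_eq0// => /allP /(_ i (mem_index_enum _)) /=.
rewrite psumr_eq0 => [|? _]; last by rewrite exprn_ge0.
move=> /allP /(_ j (mem_index_enum _)).
by rewrite /= sqrf_eq0 normr_eq0 => /eqP.
Qed.

(** This expresses the trace against [X ^t* *m X] by finitely many diagonal matrix elements of [A],
    the quantities controlled by weak operator convergence. *)
Lemma trace_gram_mul m n (X : 'M[C]_(m, n)) (A : 'M[C]_n) :
  \tr (X ^t* *m X *m A) =
  \sum_i ((X ^t* *m delta_mx i (0 : 'I_1)) ^t* *m A
           *m (X ^t* *m delta_mx i (0 : 'I_1))) 0 0.
Proof.
rewrite -mulmxA mxtrace_mulC; apply: eq_bigr => i _.
rewrite trmxC_mul trmxCK !mulmxA trmx_delta map_delta_mx -colE.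
by rewrite -!mulmxA -rowE !mxE.
Qed.

Lemma trace_mul_inj n (A B : 'M[C]_n) :
  (forall X, \tr (X *m A) = \tr (X *m B)) -> A = B.
Proof.
move=> AB; apply/eqP; rewrite -subr_eq0; apply/eqP/trace_gram_eq0.
by rewrite mulmxBr linearB /= AB subrr.
Qed.

Lemma psd_gram m n (X : 'M[C]_(m, n)) : psdmx (X ^t* *m X).
Proof.
move=> v; rewrite -trace_mx11 mulmxA -trmxC_mul -mulmxA.
exact: trace_gram_ge0.
Qed.

Lemma psd_projection n (P : 'M[C]_n) : P ^t* = P -> P *m P = P -> psdmx P.
Proof. by move=> Ph PP; have := psd_gram P; rewrite Ph PP. Qed.

Lemma projection_compl n (P : 'M[C]_n) : P ^t* = P -> P *m P = P ->
  (1%:M - P) ^t* = 1%:M - P /\ (1%:M - P) *m (1%:M - P) = 1%:M - P.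
Proof.
move=> Ph PP; rewrite trmxCD trmxCN Ph trmx1 map_mx1; split=> //.
by rewrite mulmxBr mulmxBl mul1mx mulmx1 mulmxBl mul1mx PP subrr subr0.
Qed.

(** For [v != 0] the scalar is the squared norm of [v] and [P] projects onto its line; for [v = 0]
    both are taken to be 0. *)
Lemma rank1_projection n (v : 'cV[C]_n) : exists2 P : 'M[C]_n,
  P ^t* = P /\ P *m P = P & exists2 c : C, 0 <= c & v *m v ^t* = c *: P.
Proof.
have [->|v0] := eqVneq v 0.
  exists 0; first by rewrite trmx0 map_mx0 mulmx0.
  by exists 0; rewrite ?mul0mx ?scaler0.
pose c := \tr (v ^t* *m v).
have c0 : c != 0 by apply: contra_neq v0 => /trace_gram_eq0.
have c_ge0 : 0 <= c by exact: trace_gram_ge0.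
have vv : v ^t* *m v = c%:M by rewrite [LHS]mx11_scalar -trace_mx11.
exists (c^-1 *: (v *m v ^t*)); last first.
  by exists c; rewrite // scalerA divff// scale1r.
split.
  rewrite trmxCZ trmxC_mul trmxCK; congr (_ *: _).
  by rewrite conj_Creal// ger0_real// invr_ge0.
rewrite -scalemxAl -scalemxAr scalerA -mulmxA (mulmxA (v ^t*)) vv.
by rewrite mul_scalar_mx -scalemxAr scalerA -mulrA mulVf// mulr1.
Qed.

(** Spectral theorem: a Hermitian matrix is normal, hence unitarily diagonalizable, and square roots
    of the eigenvalues give [X]. *)
Lemma psd_factor n (A : 'M[C]_n) :
  psdmx A -> exists X : 'M[C]_n, A = X ^t* *m X.
Proof.
move=> Apsd; have Aherm := psd_trmxC Apsd.
have /orthomx_spectralP Aspec : A \is normalmx.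
  by apply/normalmxP; rewrite Aherm.
have Pu := spectral_unitarymx A.
set P := spectralmx A in Aspec Pu; set s := spectral_diag A in Aspec.
(* Each eigenvalue is the value of the form at the eigenvector [P ^t* *m delta_mx i 0]. *)
have s_ge0 i : 0 <= s 0 i.
  have := Apsd (P ^t* *m delta_mx i 0); rewrite trmxC_mul trmxCK.
  rewrite {}Aspec invmx_unitary// !mulmxA -(mulmxA _ P) (unitarymxP Pu) mulmx1.
  rewrite -(mulmxA _ P) (unitarymxP Pu) mulmx1 trmx_delta map_delta_mx.
  by rewrite -rowE -colE !mxE eqxx mulr1n.
exists (diag_mx (map_mx sqrtC s) *m P).
rewrite trmxC_mul {1}Aspec invmx_unitary// !mulmxA.
rewrite -(mulmxA (P ^t*) _ (diag_mx _)).
congr (_ *m _ *m _); rewrite tr_diag_mx map_diag_mx mulmx_diag; congr diag_mx.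
apply/rowP => i; rewrite !mxE.
by rewrite /= conj_Creal ?ger0_real ?sqrtC_ge0// -expr2 sqrtCK.
Qed.

(** For [A = X ^t* *m X] and [B = Y ^t* *m Y] the trace is the squared Frobenius norm of
    [X *m Y ^t*]. *)
Lemma psd_trace_ge0 n (A B : 'M[C]_n) : psdmx A -> psdmx B -> 0 <= \tr (A *m B).
Proof.
move=> /psd_factor[X ->] /psd_factor[Y ->].
rewrite mulmxA mxtrace_mulC !mulmxA -mulmxA.
by rewrite -[X in X *m _]trmxCK trmxC_mul trmxCK trace_gram_ge0.
Qed.

(** For [A = X ^t* *m X] the trace is the squared Frobenius norm of [X *m P], so [X *m P = 0], and
    the adjoint of this kills [P *m A]. *)
Lemma psd_trace_eq0 n (A P : 'M[C]_n) : psdmx A -> P ^t* = P -> P *m P = P ->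
  \tr (A *m P) = 0 -> P *m A = 0.
Proof.
move=> /psd_factor[X ->] Ph PP; rewrite -{1}PP mulmxA mxtrace_mulC !mulmxA.
rewrite -{1}Ph -trmxC_mul -mulmxA => /trace_gram_eq0 XP0.
by rewrite -{1}Ph -trmxC_mul XP0 trmx0 map_mx0 mul0mx.
Qed.

Lemma psd_conj n (A X : 'M[C]_n) : psdmx A -> psdmx (X ^t* *m A *m X).
Proof.
by move=> Apsd v; have := Apsd (X *m v); rewrite trmxC_mul !mulmxA.
Qed.

Lemma psdD n (A B : 'M[C]_n) : psdmx A -> psdmx B -> psdmx (A + B).
Proof.
by move=> Ap Bp v; rewrite mulmxDr mulmxDl mxE addr_ge0.
Qed.

Lemma psd0 n : psdmx (0 : 'M[C]_n).
Proof. by move=> v; rewrite mulmx0 mul0mx mxE. Qed.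

Lemma psd_sum n (I : finType) (Q : pred I) (A : I -> 'M[C]_n) :
  (forall i, Q i -> psdmx (A i)) -> psdmx (\sum_(i | Q i) A i).
Proof. by move=> Ap; apply: big_ind Ap => //; [exact: psd0|exact: psdD]. Qed.

End PositiveMatrices.

(** * Integration of complex-valued functions *)

Section ComplexIntegral.
Context {R : realType} {d} {T : measurableType d}.
Variable mu : {measure set T -> \bar R}.
Local Notation C := R[i].
Implicit Types (f g : T -> C) (v w c : C).

Definition cintegrable f : Prop :=
  mu.-integrable setT (EFin \o (@complex.Re R \o f)) /\
  mu.-integrable setT (EFin \o (@complex.Im R \o f)).

(** Integrability travels with the value, so that the linearity rules compose without side
    conditions; the value has the form of the entries of [mx_integral]. *)
Definition has_cintegral f v : Prop :=
  cintegrable f /\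
  v = (\int[mu]_x complex.Re (f x))%R +i* (\int[mu]_x complex.Im (f x))%R.

Lemma has_cintegral_unique f v w :
  has_cintegral f v -> has_cintegral f w -> v = w.
Proof. by move=> [_ ->] [_ ->]. Qed.

Lemma eq_has_cintegral f g v :
  (forall x, f x = g x) -> has_cintegral f v -> has_cintegral g v.
Proof. by move=> /funext ->. Qed.

Lemma has_cintegral0 : has_cintegral (fun=> 0) 0.
Proof.
split; first by split; exact: integrable0.
by rewrite !Rintegral_cst// !mul0r.
Qed.

Lemma has_cintegralD f g v w : has_cintegral f v -> has_cintegral g w ->
  has_cintegral (fun x => f x + g x) (v + w).
Proof.
move=> [[fr fi] ->] [[gr gi] ->].
have ReD x : complex.Re (f x + g x) = complex.Re (f x) + complex.Re (g x).
  by case: (f x) (g x) => ? ? [].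
have ImD x : complex.Im (f x + g x) = complex.Im (f x) + complex.Im (g x).
  by case: (f x) (g x) => ? ? [].
split; first split.
- rewrite [X in _.-integrable _ X](_ : _ = (EFin \o (@complex.Re R \o f)) \+
    (EFin \o (@complex.Re R \o g)))%E; first exact: integrableD.
  by apply/funext => x /=; rewrite ReD.
- rewrite [X in _.-integrable _ X](_ : _ = (EFin \o (@complex.Im R \o f)) \+
    (EFin \o (@complex.Im R \o g)))%E; first exact: integrableD.
  by apply/funext => x /=; rewrite ImD.
by congr (_ +i* _); rewrite -RintegralD//; apply: eq_Rintegral => x _.
Qed.

Lemma has_cintegralZ c f v :
  has_cintegral f v -> has_cintegral (fun x => c * f x) (c * v).
Proof.
move=> [[fr fi] ->]; case: c => a b.
have ReM x : complex.Re ((a +i* b) * f x) =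
    a * complex.Re (f x) + - b * complex.Im (f x).
  by case: (f x) => ? ? /=; rewrite mulNr.
have ImM x : complex.Im ((a +i* b) * f x) =
    a * complex.Im (f x) + b * complex.Re (f x).
  by case: (f x).
have intZ (k : R) (h : T -> R) : mu.-integrable setT (EFin \o h) ->
    mu.-integrable setT (EFin \o (fun x => k * h x)).
  by move=> hi; exact: (integrableZl measurableT k hi).
have intZD (k l : R) (h h' : T -> R) : mu.-integrable setT (EFin \o h) ->
    mu.-integrable setT (EFin \o h') ->
    mu.-integrable setT (EFin \o (fun x => k * h x + l * h' x)).
  move=> hi hi'; rewrite [X in _.-integrable _ X](_ : _ =
    (EFin \o (fun x => k * h x)%R) \+ (EFin \o (fun x => l * h' x)%R))%E//.
  by apply: integrableD => //; exact: intZ.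
split; first split.
- rewrite (_ : _ \o _ = fun x => a * complex.Re (f x) + - b * complex.Im (f x)).
    exact: intZD.
  by apply/funext => x; exact: ReM.
- rewrite (_ : _ \o _ = fun x => a * complex.Im (f x) + b * complex.Re (f x)).
    exact: intZD.
  by apply/funext => x; exact: ImM.
rewrite (eq_Rintegral _ (fun x _ => ReM x)) (eq_Rintegral _ (fun x _ => ImM x)).
by rewrite !RintegralD ?RintegralZl ?mulNr//; exact: intZ.
Qed.

Lemma has_cintegral_sum (I : Type) (s : seq I) (F : I -> T -> C) (v : I -> C) :
  (forall i, has_cintegral (F i) (v i)) ->
  has_cintegral (fun x => \sum_(i <- s) F i x) (\sum_(i <- s) v i).
Proof.
move=> Fv; elim: s => [|i s IHs].
  rewrite big_nil; apply: eq_has_cintegral has_cintegral0 => x.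
  by rewrite big_nil.
rewrite big_cons; apply: eq_has_cintegral (has_cintegralD (Fv i) IHs) => x.
by rewrite big_cons.
Qed.

Lemma has_cintegral_ge0 f v :
  (forall x, 0 <= f x) -> has_cintegral f v -> 0 <= v.
Proof.
move=> f0 [_ ->]; rewrite lecE /=; apply/andP; split.
  apply/eqP; transitivity (\int[mu]_(x in setT) (0 : R))%R; last first.
    by rewrite Rintegral_cst// mul0r.
  apply: eq_Rintegral => x _ /=.
  by have := f0 x; rewrite lecE => /andP[/eqP -> _].
by apply: Rintegral_ge0 => x _; have := f0 x; rewrite lecE => /andP[].
Qed.

(** Matrix integrals are handled through trace functionals: this reduces positivity, invariance and
    equality of averages to scalar integrals. *)
Lemma trace_mx_integral n (B : 'M[C]_n) (F : T -> 'M[C]_n) :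
  (forall i j, cintegrable (fun x => F x i j)) ->
  has_cintegral (fun x => \tr (B *m F x)) (\tr (B *m mx_integral mu F)).
Proof.
move=> Fint.
have H : has_cintegral (fun x => \sum_i \sum_j B i j * F x j i)
    (\sum_i \sum_j B i j * mx_integral mu F j i).
  do 2![apply: has_cintegral_sum => ?]; apply: has_cintegralZ.
  by split=> //; rewrite mxE.
rewrite (_ : \tr _ = \sum_i \sum_j B i j * mx_integral mu F j i).
  by apply: eq_has_cintegral H => x; apply: eq_bigr => i _; rewrite mxE.
by apply: eq_bigr => i _; rewrite mxE.
Qed.

End ComplexIntegral.

(** * Limits of real and imaginary parts *)

Section ComplexLimits.
Context {R : realType} {T : Type} {F : set_system T} {FF : Filter F}.
Implicit Types (f : T -> R[i]^o) (l : R[i]^o).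

(** Real and imaginary parts are treated at once, as subtractive maps that do not increase the
    modulus. *)
Let cvg_part (h : R[i] -> R) f l : (forall a b, h a - h b = h (a - b)) ->
  (forall a, `|h a|%:C <= `|a|) -> f @ F --> l -> (h \o f) @ F --> h l.
Proof.
move=> hB hle fl; apply/cvgrPdist_lt => e e0 /=.
have /cvgrPdist_lt /(_ e%:C) := fl; rewrite ltcR => /(_ e0).
by apply: filterS => y /=; rewrite hB -ltcR; exact/le_lt_trans/hle.
Qed.

Lemma cvg_Re f l : f @ F --> l -> (@complex.Re R \o f) @ F --> complex.Re l.
Proof. by apply: cvg_part => [[? ?] []//|]; exact: normc_ge_Re. Qed.

Lemma cvg_Im f l : f @ F --> l -> (@complex.Im R \o f) @ F --> complex.Im l.
Proof.
apply: cvg_part => [[? ?] []//|[a b]].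
by rewrite normc_def /= lecR -sqrtr_sqr ler_wsqrtr// lerDr sqr_ge0.
Qed.

End ComplexLimits.

(** * Continuous functions on a compact probability space *)

Section BorelIntegral.
Context {R : realType} {T : ptopologicalType}.
Variable mu : probability (borel T) R.
Hypothesis compactT : compact [set: T].

Lemma continuous_borel_measurable (f : T -> R) :
  continuous f -> measurable_fun setT (f : borel T -> R).
Proof.
move=> /continuousP cf.
apply: (measurability _ (measurable_realfun.RGenOpens.measurableE R)).
move=> _ [_ [a [b ->] <-]]; rewrite setTI; apply: sub_sigma_algebra.
exact/cf/interval_open.
Qed.

(** Compactness bounds [f], and a bounded measurable function is integrable for a finite measure. *)
Lemma continuous_integrable (f : T -> R) :
  continuous f -> mu.-integrable setT (EFin \o (f : borel T -> R)).
Proof.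
move=> cf; apply: measurable_bounded_integrable => //.
- by rewrite (le_lt_trans (probability_le1 mu measurableT))// ltry.
- exact: continuous_borel_measurable.
- have /compact_bounded[M [_ mrt]] : compact ((f : T -> R^o) @` setT).
    by apply: continuous_compact => //; exact: continuous_subspaceT.
  exists M; split; rewrite ?num_real// => r Mr x _; apply: (mrt r Mr).
  by exists x.
Qed.

Lemma continuous_cintegrable (f : T -> R[i]^o) :
  continuous f -> cintegrable mu (f : borel T -> R[i]).
Proof.
move=> cf; split; apply: continuous_integrable => x.
- exact: cvg_Re (cf x).
- exact: cvg_Im (cf x).
Qed.

End BorelIntegral.

(** * Continuity of matrix entries under conjugation *)

Lemma cvg_sum {K : numFieldType} {T : Type} {F : set_system T} {FF : Filter F}
    (I : Type) (s : seq I) (f : I -> T -> K) (l : I -> K) :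
  (forall i, f i @ F --> l i) ->
  (fun x => \sum_(i <- s) f i x) @ F --> \sum_(i <- s) l i.
Proof.
move=> fl; elim: s => [|i s IHs].
  by under eq_fun do rewrite big_nil; rewrite big_nil; exact: cvg_cst.
under eq_fun do rewrite big_cons; rewrite big_cons.
by apply: cvgD; [exact: fl|exact: IHs].
Qed.

Section ContinuousEntries.
Local Open Scope sesquilinear_scope.
Context {K : numClosedFieldType} {T : topologicalType}.

Lemma continuous_conjC (f : T -> K) :
  continuous f -> continuous (fun x => ((f x)^*)%R).
Proof.
move=> cf x; apply/cvgrPdist_lt => e e0.
have /cvgrPdist_lt /(_ e e0) := cf x; apply: filterS => y.
by rewrite -rmorphB /= norm_conjC.
Qed.

Lemma continuous_big_sum (I : Type) (s : seq I) (f : I -> T -> K) :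
  (forall i, continuous (f i)) -> continuous (fun x => \sum_(i <- s) f i x).
Proof. by move=> cf x; apply: cvg_sum => i; exact: cf. Qed.

Lemma continuous_conjugation n (U : T -> 'M[K]_n) (A : 'M[K]_n) :
  (forall i j, continuous (fun g => U g i j)) ->
  forall i j, continuous (fun g => (U g *m A *m (U g) ^t*) i j).
Proof.
move=> cU i j; under eq_fun do rewrite mxE.
apply: continuous_big_sum => k x; under eq_fun do rewrite !mxE.
apply: cvgM; last exact: (continuous_conjC (cU j k)).
apply: continuous_big_sum => l y; apply: cvgM; last exact: cvg_cst.
exact: cU.
Qed.

End ContinuousEntries.

(** * Haar averages of operators *)

Section HaarAverage.
Local Open Scope sesquilinear_scope.
Context {R : realType} {G : topGroupType}.
Hypothesis compactG : compact [set: G].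
Variable mu : probability (borel G) R.
Hypothesis haar_mu : normalized_haar mu.
Local Notation C := R[i].

Lemma translation_measurable (h : G) :
  measurable_fun setT (fun g : borel G => (h * g)%g : borel G).
Proof.
apply: (@measurability _ _ (borel G) (borel G) _ _ (@open G)) => //.
move=> _ [A oA <-]; rewrite setTI; apply: sub_sigma_algebra.
have /continuousP : continuous (fun g : G => (h * g)%g).
  move=> g; apply: (@continuous_comp _ _ _ (fun g => (h, g))
                     (fun gh : G * G => (gh.1 * gh.2)%g)).
    by apply: cvg_pair => //=; exact: cvg_cst.
  exact: mulg_continuous.
exact.
Qed.

(** Change of variables: by left invariance, the pushforward of [mu] along the translation agrees
    with [mu] on measurable sets. *)
Lemma Rintegral_translation (h : G) (f : borel G -> R) :
  mu.-integrable setT (EFin \o f) ->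
  mu.-integrable setT (EFin \o (fun g : borel G => f (h * g)%g)) ->
  (\int[mu]_g f (h * g)%g)%R = (\int[mu]_g f g)%R.
Proof.
move=> fi fhi; congr fine.
have mh := translation_measurable h.
have := integral_pushforward mh (measurable_int mu fi) (D := setT) fhi
  measurableT.
rewrite preimage_setT => <-; apply: eq_measure_integral => A mA _.
exact: haar_mu.1.
Qed.

Lemma has_cintegral_translation (h : G) (f : borel G -> C) v w :
  has_cintegral mu f v -> has_cintegral mu (fun g : borel G => f (h * g)%g) w ->
  v = w.
Proof.
move=> [[fr fi] ->] [[fhr fhi] ->].
by rewrite (Rintegral_translation (f := @complex.Re R \o f) fr fhr)
  (Rintegral_translation (f := @complex.Im R \o f) fi fhi).
Qed.

Lemma has_cintegral_cst (c : C) : has_cintegral mu (fun=> c) c.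
Proof.
have mu1 : fine (mu setT) = 1 by rewrite probability_setT.
split; last by rewrite !Rintegral_cst//= mu1 !mulr1; case: c.
by split; apply: (finite_measure_integrable_cst mu).
Qed.

Variables (n : nat) (U : G -> 'M[C]_n).
Hypothesis repU : unitary_rep U.

Lemma rep_unitary g : U g *m (U g) ^t* = 1%:M.
Proof. by case: repU => /(_ g)/unitarymxP. Qed.

Lemma rep_unitaryV g : (U g) ^t* *m U g = 1%:M.
Proof. exact/mulmx1C/rep_unitary. Qed.

(** Strong continuity at the basis vectors [delta_mx j 0] gives continuity of the columns of
    [U g]. *)
Lemma rep_entry_continuous i j : continuous (fun g => U g i j : C^o).
Proof.
case: repU => _ _ _ cU g.
have -> : (fun g => U g i j : C^o) =
    (fun M : 'cV[C^o]_n => M i 0) \o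
    (fun g => U g *m delta_mx j 0 : 'cV[C^o]_n).
  by apply/funext => x /=; rewrite -colE mxE.
by apply: continuous_comp; [exact: cU|exact: coord_continuous].
Qed.

(** The twirl of [A]; at [rho (repr eta)] it is [orbit_average] by conversion. *)
Definition haar_average (A : 'M[C]_n) : 'M[C]_n :=
  mx_integral mu (fun g : borel G => U g *m A *m (U g) ^t*).

Lemma trace_haar_average (B A : 'M[C]_n) :
  has_cintegral mu (fun g : borel G => \tr (B *m (U g *m A *m (U g) ^t*)))
    (\tr (B *m haar_average A)).
Proof.
apply: trace_mx_integral => i j; apply: (continuous_cintegrable mu compactG).
exact: (@continuous_conjugation C^o G n U A rep_entry_continuous).
Qed.

(** When [B] commutes with the representation, cyclicity of the trace makes the integrand constant,
    equal to [\tr (B *m A)]. *)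
Lemma trace_commutant_average (B A : 'M[C]_n) :
  commutant U B -> \tr (B *m haar_average A) = \tr (B *m A).
Proof.
move=> BU; apply: has_cintegral_unique (trace_haar_average B A) _.
apply: eq_has_cintegral (has_cintegral_cst _) => g.
by rewrite !mulmxA BU [RHS]mxtrace_mulC !mulmxA rep_unitaryV mul1mx.
Qed.

Lemma haar_average_trace (A : 'M[C]_n) : \tr (haar_average A) = \tr A.
Proof.
rewrite -[in LHS](mul1mx (haar_average A)) trace_commutant_average ?mul1mx//.
by move=> g; rewrite mul1mx mulmx1.
Qed.

Lemma haar_average_psd (A : 'M[C]_n) : psd A -> psd (haar_average A).
Proof.
move=> Ap v; rewrite form_trace mxtrace_mulC.
apply: has_cintegral_ge0 (trace_haar_average _ A) => g.
rewrite mxtrace_mulC -form_trace; move: v.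
have := psd_conj ((U g) ^t*) (Ap : psdmx A); rewrite trmxCK; exact.
Qed.

(** Unitarity lets [1%:M] be moved under the integral, where the integrand becomes the form of
    [1%:M - A] conjugated by [U g]. With positivity, this shows that averaging preserves effects. *)
Lemma haar_average_le1 (A : 'M[C]_n) :
  psd (1%:M - A) -> psd (1%:M - haar_average A).
Proof.
move=> Ap v; rewrite form_trace mxtrace_mulC; set B := v *m _.
have -> : \tr (B *m (1%:M - haar_average A)) =
    \tr B + -1 * \tr (B *m haar_average A).
  by rewrite mulmxBr mulmx1 mulN1r linearB.
apply: has_cintegral_ge0 (has_cintegralD (has_cintegral_cst _)
  (has_cintegralZ (-1) (trace_haar_average B A))) => g.
have -> : \tr B + -1 * \tr (B *m (U g *m A *m (U g) ^t*)) =
    \tr ((U g *m (1%:M - A) *m (U g) ^t*) *m B).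
  rewrite mulmxBr mulmxBl mulmx1 rep_unitary mulmxBl mul1mx linearB /= mulN1r.
  by rewrite [\tr (_ *m B)]mxtrace_mulC.
rewrite -form_trace; move: v @B => v _; move: v.
have := psd_conj ((U g) ^t*) (Ap : psdmx (1%:M - A)); rewrite trmxCK; exact.
Qed.

Lemma haar_average_commutant (A : 'M[C]_n) : commutant U (haar_average A).
Proof.
case: repU => _ _ UM _ h.
have avgK : (U h) ^t* *m haar_average A *m U h = haar_average A.
  apply: trace_mul_inj => B.
  have -> : \tr (B *m ((U h) ^t* *m haar_average A *m U h)) =
      \tr ((U h *m B *m (U h) ^t*) *m haar_average A).
    by rewrite mulmxA mxtrace_mulC !mulmxA.
  (* By cyclicity, conjugating [B] by [U h] amounts to replacing [g] by [h^-1 * g] in the integrand,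
     which left invariance permits. *)
  apply/esym; apply: (@has_cintegral_translation h^-1%g)
    (trace_haar_average _ _) _.
  apply: eq_has_cintegral (trace_haar_average _ _) => g.
  have UV : U (h^-1)%g = (U h) ^t*.
    rewrite -[RHS]mulmx1 -(mulmx1 (U _)) -{1}(rep_unitary h) mulmxA -UM mulVg.
    by case: repU => _ -> _ _; rewrite mul1mx mulmx1.
  by rewrite UM UV trmxC_mul trmxCK !mulmxA [RHS]mxtrace_mulC !mulmxA.
by rewrite -{2}avgK !mulmxA rep_unitary mul1mx.
Qed.

End HaarAverage.

(** * Finite discrete spaces are standard Borel *)

Section DiscreteStandardBorel.

(* [discrete_topology] has no pointed uniform structure, which completeness
   requires. *)
Definition discrete_space (T : pointedType) : Type := T.

HB.instance Definition _ (T : pointedType) := Pointed.on (discrete_space T).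
HB.instance Definition _ (T : pointedType) :=
  hasNbhs.Build (discrete_space T) principal_filter.
HB.instance Definition _ (T : pointedType) :=
  Discrete_ofNbhs.Build (discrete_space T) erefl.
HB.instance Definition _ (T : pointedType) :=
  DiscreteUniform_ofNbhs.Build (discrete_space T).
HB.instance Definition _ {R : numDomainType} (T : pointedType) :=
  @DiscretePseudoMetric_ofUniform.Build R (discrete_space T).

(** The diagonal is an entourage, so a Cauchy filter contains [A] and [B] whose product lies in the
    diagonal; a common point [x] of both forces [A] inside the singleton of [x]. *)
Lemma discrete_complete (T : pointedType) (F : set_system (discrete_space T)) :
  ProperFilter F -> cauchy F -> cvg F.
Proof.
move=> FF /(_ [set xy | xy.1 = xy.2]).
case; first by rewrite nbhs_simpl uniform_discrete => _ [x _ <-].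
move=> [A B] /= [FA FB] ABd.
have [x [Ax Bx]] := @filter_ex _ F _ _ (@filterI _ F _ A B FA FB).
apply/cvg_ex; exists x; apply/discrete_cvg; apply: filterS FA => y Ay.
exact: (ABd (y, x)).
Qed.

HB.instance Definition _ (T : pointedType) :=
  Uniform_isComplete.Build (discrete_space T) (@discrete_complete T).

Lemma standard_borel_discrete (R : realType) (Z : finType) (z0 : Z) :
  standard_borel R (discrete_outcomes z0).
Proof.
exists (discrete_space (discrete_outcomes z0)); split.
- exact: discrete_hausdorff.
- exists setT; last by move=> O; rewrite setIT.
  by apply: finite_set_countable; exact: finite_finset.
- exists id, id; split=> // _ B _; rewrite setTI //.
  by apply: sub_sigma_algebra; exact: discrete_open.
Qed.

End DiscreteStandardBorel.

(** * POVMs with finitely many outcomes *)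

Section BlockLabel.
Local Open Scope sesquilinear_scope.
Context {R : realType} {n : nat} {Z : finType} {z0 : Z}.
Variable P : Z -> 'M[R[i]]_n.
Hypothesis P_psd : forall z, psd (P z).
Hypothesis P_sum : \sum_z P z = 1%:M.

Lemma block_label1 (z : Z) :
  block_label P [set (z : discrete_outcomes z0)] = P z.
Proof.
rewrite /block_label (@big_pred1 _ _ _ Z z)// => z' /=.
by apply/idP/eqP => [/set_mem //|->]; exact/mem_set.
Qed.

Lemma block_label_form (u v : 'cV[R[i]]_n) (B : set (discrete_outcomes z0)) :
  \tr (u ^t* *m block_label P B *m v) =
  \sum_(z : Z | z \in (B : set Z)) \tr (u ^t* *m P z *m v).
Proof. by rewrite /block_label mulmx_sumr mulmx_suml raddf_sum. Qed.

Lemma block_label_povm : is_povm (block_label (z0 := z0) P).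
Proof.
split.
- exact: standard_borel_discrete.
- by move=> B _; apply: (psd_sum (A := P)) => z _; exact: P_psd.
- by rewrite /block_label -P_sum; apply: eq_bigl => z; rewrite in_setT.
move=> B _ tB u v; apply: cvg_near_cst.
(* [k z] is the index of the set containing [z], or 0 if there is none. By disjointness no other set
   contains [z], so the partial sums are constant once every [k z] has been passed. *)
have [k Bk] : {k : Z -> nat & forall z : Z, (\bigcup_k B k) z -> B (k z) z}.
  apply: (@choice Z nat (fun z k => (\bigcup_k B k) z -> B k z)) => z.
  have [[k _ Bkz]|nBz] := pselect ((\bigcup_k B k) z); first by exists k.
  by exists 0%N.
exists (\max_z k z).+1 => // m /= km; rewrite -!trace_mx11 block_label_form.
under eq_bigr do rewrite -trace_mx11 block_label_form big_mkcond.
rewrite exchange_big [RHS]big_mkcond; apply: eq_bigr => z _.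
have [/set_mem Bz|nBz] := ifPn; last first.
  apply: big1 => j _; case: ifPn => // /set_mem Bj; case/negP: nBz.
  by apply/mem_set; exists j.
have kzm : (k z < m)%N by rewrite (leq_trans _ km)// ltnS leq_bigmax.
rewrite (bigD1_seq (k z)) ?mem_index_iota ?iota_uniq//=.
rewrite mem_set ?big1 ?addr0//; last exact: Bk.
move=> j /eqP jk; case: ifPn => // /set_mem Bj; case: jk.
by apply: (tB j (k z)) => //; exists z; split => //; exact: Bk.
Qed.

End BlockLabel.

(** * Outcome laws given by the Born rule *)

Section Born.
Local Open Scope sesquilinear_scope.
Context {R : realType} {n : nat}.
Local Notation C := R[i].

Lemma Re_sum (I : Type) (s : seq I) (Q : pred I) (F : I -> C) :
  complex.Re (\sum_(i <- s | Q i) F i) = \sum_(i <- s | Q i) complex.Re (F i).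
Proof. by apply: big_morph => // -[? ?] []. Qed.

Lemma mxtrace_sum (I : Type) (s : seq I) (Q : pred I) (F : I -> 'M[C]_n) :
  \tr (\sum_(i <- s | Q i) F i) = \sum_(i <- s | Q i) \tr (F i).
Proof. exact: raddf_sum. Qed.

Lemma bornE (A B : 'M[C]_n) :
  psd A -> psd B -> (born A B)%:C = \tr (A *m B).
Proof. by move=> Ap Bp; apply/RRe_real/ger0_real/(psd_trace_ge0 Ap Bp). Qed.

Lemma born_ge0 (A B : 'M[C]_n) : psd A -> psd B -> 0 <= born A B.
Proof. by move=> Ap Bp; rewrite -ler0c (bornE Ap Bp) (psd_trace_ge0 Ap Bp). Qed.

Lemma born_sumr (I : finType) (Q : pred I) (A : 'M[C]_n) (B : I -> 'M[C]_n) :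
  born A (\sum_(i | Q i) B i) = \sum_(i | Q i) born A (B i).
Proof. by rewrite /born mulmx_sumr mxtrace_sum Re_sum. Qed.

Lemma born_suml (I : finType) (a : I -> R) (A : I -> 'M[C]_n) (B : 'M[C]_n) :
  born (\sum_i (a i)%:C *: A i) B = \sum_i a i * born (A i) B.
Proof.
rewrite /born mulmx_suml mxtrace_sum Re_sum; apply: eq_bigr => i _.
by rewrite -scalemxAl mxtraceZ; case: (\tr _) => x y /=; rewrite mul0r subr0.
Qed.

Lemma born1 (A : 'M[C]_n) : \tr A = 1 -> born A 1%:M = 1.
Proof. by rewrite /born mulmx1 => ->. Qed.

Context {d : measure_display} {Y : measurableType d}.
Variables (A : 'M[C]_n) (N : set Y -> 'M[C]_n).
Hypotheses (A_psd : psd A) (N_povm : is_povm N).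

(** Factoring [A] as [X ^t* *m X] turns the Born weight into a finite sum of diagonal matrix
    elements, to each of which weak additivity of [N] applies. *)
Lemma born_povm_sigma_additive (B : (set Y)^nat) :
  (forall k, measurable (B k)) -> trivIset setT B ->
  (fun m => \sum_(0 <= k < m) born A (N (B k)))
    @ \oo --> born A (N (\bigcup_k B k)).
Proof.
move=> mB tB; have [X AX] := psd_factor A_psd.
have bornX M : born A M = complex.Re (\sum_i
    (((X ^t* *m delta_mx i (0 : 'I_1)) ^t* *m M
      *m (X ^t* *m delta_mx i (0 : 'I_1))) 0 0)).
  by rewrite /born AX trace_gram_mul.
case: N_povm => _ _ _ /(_ B mB tB) N_sigma.
rewrite bornX; under eq_fun do (under eq_bigr do rewrite bornX;
  rewrite -Re_sum exchange_big).
apply: (cvg_Re (f := fun m => \sum_i \sum_(0 <= k < m) _)).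
by apply: (@cvg_sum C^o) => i; exact: N_sigma.
Qed.

(** Additivity along the constantly empty sequence makes a series with constant term
    [born A (N set0)] converge, so this term is 0. *)
Lemma born_povm0 : born A (N set0) = 0.
Proof.
have := @born_povm_sigma_additive (fun=> set0) (fun=> measurable0).
rewrite bigcup0// => /(_ (@trivIset_set0 _ _ _)) cvg0.
have /cvg_series_cvg_0 : cvgn (series (fun=> born A (N set0))).
  by apply/cvg_ex; eexists; exact: cvg0.
by move/cvg_lim => <- //; rewrite lim_cst.
Qed.

Lemma povm_law_exists : \tr A = 1 ->
  exists P : probability Y R, forall B, measurable B -> P B = (born A (N B))%:E.
Proof.
move=> A1.
(* A measure is nonnegative on all sets, whereas [N] is known to be positive on measurable ones;
   hence the value 0 elsewhere. *)
pose f B : \bar R := if `[< measurable B >] then (born A (N B))%:E else 0%E.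
have fE B : measurable B -> f B = (born A (N B))%:E.
  by move=> mB; rewrite /f; case: asboolP.
case: (N_povm) => _ N_psd N1 _.
have f0 : f set0 = 0%E by rewrite fE// born_povm0.
have f_ge0 B : (0 <= f B)%E.
  rewrite /f; case: asboolP => // mB; rewrite lee_fin.
  exact: (born_ge0 A_psd (N_psd B mB)).
have f_sigma : semi_sigma_additive f.
  move=> B mB tB mUB; rewrite fE//.
  under eq_fun do (under eq_bigr do rewrite fE//; rewrite sumEFin).
  apply: cvg_EFin; first by apply: nearW.
  exact: born_povm_sigma_additive.
have fT : f setT = 1%E by rewrite fE// N1 born1.
pose fM := isMeasure.Build _ _ _ f f0 f_ge0 f_sigma.
pose fm : {measure set Y -> \bar R} := HB.pack f fM.
pose fP := Measure_isProbability.Build _ _ _ fm fT.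
pose P : probability Y R := HB.pack f fM fP.
by exists P.
Qed.

End Born.

(** * Kernels and integrals on a finite discrete space *)

Section DiscreteKernel.
Context {R : realType} {Z : finType} {z0 : Z}.
Local Notation X := (discrete_outcomes z0).
Context {d : measure_display} {Y : measurableType d}.

Lemma discrete_kernel_exists (P : Z -> probability Y R) :
  exists K : R.-pker X ~> Y, forall z B, K z B = P z B.
Proof.
pose k (z : X) : {measure set Y -> \bar R} := P z.
have kT z : k z setT = 1%E by exact: probability_setT.
have kK : isKernel _ _ X Y R k by split.
pose kk : R.-ker X ~> Y := HB.pack k kK.
pose kP := Kernel_isProbability.Build _ _ _ _ _ kk kT.
pose K : R.-pker X ~> Y := HB.pack k kK kP.
by exists K.
Qed.

(** The outcome law equals, as a set function, a finite sum of scaled Dirac measures, against which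
    the integral is a weighted sum. *)
Lemma integral_block_label n (A : 'M[R[i]]_n) (P : Z -> 'M[R[i]]_n)
    (f : X -> \bar R) :
  psd A -> (forall z, psd (P z)) -> (forall x, (0 <= f x)%E) ->
  (\int[outcome_law A (block_label (z0 := z0) P)]_x f x
    = \sum_(z : Z) (born A (P z))%:E * f z)%E.
Proof.
move=> A_psd P_psd f0.
have p0 z : 0 <= born A (P z) by exact: (born_ge0 A_psd (P_psd z)).
(* [msum] is indexed by natural numbers, so [Z] is enumerated; the default [z0] is never reached for
   [k < size (enum Z)]. *)
pose e k : Z := nth z0 (enum Z) k.
pose m k : {measure set X -> \bar R} :=
  mscale (NngNum (p0 (e k))) (dirac (e k : X)).
have sum_enum (F : Z -> \bar R) :
    (\sum_(z : Z) F z = \sum_(k < size (enum Z)) F (e k))%E.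
  transitivity (\sum_(z in Z) F z)%E; first exact: eq_bigl.
  by rewrite -big_enum (big_nth z0) big_mkord.
have -> : outcome_law A (block_label (z0 := z0) P) = msum m (size (enum Z)).
  apply/funext => B; rewrite /outcome_law /block_label born_sumr big_mkcond /=.
  rewrite -sumEFin sum_enum; apply: eq_bigr => k _.
  rewrite /= /mscale /= diracE -EFinM; congr EFin.
  by case: ifP; rewrite ?mulr1 ?mulr0.
rewrite ge0_integral_measure_sum// sum_enum; apply: eq_bigr => k _.
by rewrite ge0_integral_mscale// integral_dirac// diracT mul1e.
Qed.

End DiscreteKernel.

(** * Linear algebra of a separating family *)

(** An induction principle: vectors with no common nonzero annihilator span. The index type may be
    infinite, so instead of a spanning sum the proof takes a row space [W] of maximal rank on which
    [S] holds. *)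
Lemma separating_family_ind (F : fieldType) (m : nat) (I : Type)
    (p : I -> 'rV[F]_m) (S : 'rV[F]_m -> Prop) :
  S 0 -> (forall a u v, S u -> S v -> S (a *: u + v)) ->
  (forall i, S (p i)) ->
  (forall a : 'cV[F]_m, (forall i, p i *m a = 0) -> a = 0) ->
  forall v, S v.
Proof.
move=> S0 SD Sp sep.
pose good (W : 'M[F]_m) := forall v : 'rV[F]_m, (v <= W)%MS -> S v.
have ex_rank : exists k, `[< exists2 W, good W & \rank W = k >].
  exists 0%N; apply/asboolP; exists 0; last by rewrite mxrank0.
  by move=> v; rewrite submx0 => /eqP ->.
have rank_le k : `[< exists2 W, good W & \rank W = k >] -> (k <= m)%N.
  by move=> /asboolP[W _ <-]; exact: rank_leq_row.
case: (ex_maxnP ex_rank rank_le) => _ /asboolP[W gW <-] W_max.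
(* [S] still holds on the row space of [W + p i], so maximality of the rank puts [p i] inside
   [W]. *)
have pW i : (p i <= W)%MS.
  have gWp : good <<(W + p i)%MS>>%MS.
    move=> v; rewrite genmxE => /sub_addsmxP[[a b] /= ->].
    rewrite addrC [b]mx11_scalar mul_scalar_mx; apply: SD => //.
    exact/gW/submxMl.
  have rank_le1 : (\rank (W + p i)%MS <= \rank W)%N.
    apply: W_max; apply/asboolP.
    by exists <<(W + p i)%MS>>%MS; [exact: gWp|rewrite genmxE].
  have /mxrank_leqif_sup[rank_ge] : (W <= W + p i)%MS by exact: addsmxSl.
  rewrite eqn_leq rank_ge rank_le1 /= => /esym.
  by rewrite addsmx_sub => /andP[].
(* Every column of [cokermx W] is annihilated by all [p i], hence is zero by separation. *)
have W_full : cokermx W = 0.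
  apply/matrixP => i j; rewrite mxE.
  have /(congr1 (fun M : 'cV[F]_m => M i 0)) : col j (cokermx W) = 0.
    apply: sep => k; rewrite colE mulmxA; have := pW k.
    by rewrite submxE => /eqP ->; rewrite mul0mx.
  by rewrite !mxE.
by move=> v; apply: gW; rewrite submxE W_full mulmx0.
Qed.

(** * Invariant effects and sufficiency of the block label *)

Section BlockSufficiency.
Local Open Scope sesquilinear_scope.
Context {R : realType} {G : topGroupType}.
Hypothesis compactG : compact [set: G].
Variable mu : probability (borel G) R.
Hypothesis haar_mu : normalized_haar mu.
Local Notation C := R[i].
Variables (n : nat) (U : G -> 'M[C]_n).
Hypothesis repU : unitary_rep U.

Definition invariant_effect (E : 'M[C]_n) : Prop :=
  [/\ commutant U E, psd E & psd (1%:M - E)].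

Lemma commutant_scale_add (a : C) (A B : 'M[C]_n) :
  commutant U A -> commutant U B -> commutant U (a *: A + B).
Proof.
by move=> AU BU g; rewrite mulmxDl mulmxDr -scalemxAl -scalemxAr AU BU.
Qed.

Lemma commutant0 : commutant U (0 : 'M[C]_n).
Proof. by move=> g; rewrite mul0mx mulmx0. Qed.

Lemma commutant1 : commutant U (1%:M : 'M[C]_n).
Proof. by move=> g; rewrite mul1mx mulmx1. Qed.

Lemma commutantD (A B : 'M[C]_n) :
  commutant U A -> commutant U B -> commutant U (A + B).
Proof. by move=> AU BU; rewrite -[A]scale1r; exact: commutant_scale_add. Qed.

Lemma commutantB (A B : 'M[C]_n) :
  commutant U A -> commutant U B -> commutant U (A - B).
Proof.
by move=> AU BU; rewrite addrC -scaleN1r; exact: commutant_scale_add.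
Qed.

Lemma commutant_sum (I : finType) (Q : pred I) (A : I -> 'M[C]_n) :
  (forall i, Q i -> commutant U (A i)) -> commutant U (\sum_(i | Q i) A i).
Proof.
by move=> AU; apply: big_ind AU => //; [exact: commutant0|exact: commutantD].
Qed.

Lemma commutant_invariant (A : 'M[C]_n) g :
  commutant U A -> (U g) ^t* *m A *m U g = A.
Proof. by move=> AU; rewrite -mulmxA AU mulmxA rep_unitaryV ?mul1mx. Qed.

(* On operators commuting with [U], averaging does not change the pairing with
   [v *m v ^t*], so vector states are seen by invariant effects. *)
Lemma vector_state_effect (v : 'cV[C]_n) : exists2 E, invariant_effect E &
  exists2 c : C, 0 <= c & forall A, commutant U A ->
    (v ^t* *m A *m v) 0 0 = c * \tr (A *m E).
Proof.
have [P [Ph PP] [c c0 vP]] := rank1_projection v.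
have [Ph' PP'] := projection_compl Ph PP.
exists (haar_average mu U P); first split.
- exact: haar_average_commutant.
- exact: (haar_average_psd compactG mu repU (psd_projection Ph PP)).
- exact: (haar_average_le1 compactG mu repU (psd_projection Ph' PP')).
exists c => // A AU; rewrite form_trace vP -scalemxAr mxtraceZ.
by rewrite trace_commutant_average.
Qed.

(** Through [vector_state_effect], agreement on invariant effects makes the quadratic form of
    [A - B] vanish, and polarization concludes. *)
Lemma effect_separating (A B : 'M[C]_n) : commutant U A -> commutant U B ->
  (forall E, invariant_effect E -> \tr (A *m E) = \tr (B *m E)) -> A = B.
Proof.
move=> AU BU AB; apply/eqP; rewrite -subr_eq0; apply/eqP/form_polarization => v.
have [E E_eff [c _ ->]] := vector_state_effect v; last exact: commutantB.
by rewrite mulmxBl linearB /= AB// subrr mulr0.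
Qed.

Lemma effect_psd (A : 'M[C]_n) : commutant U A ->
  (forall E, invariant_effect E -> 0 <= \tr (A *m E)) -> psd A.
Proof.
move=> AU A0 v; have [E E_eff [c c0 ->//]] := vector_state_effect v.
by rewrite mulr_ge0// A0.
Qed.

Variables (Z : finType) (z0 : Z) (Pi : Z -> 'M[C]_n).
Hypotheses (Pi_herm : forall z, (Pi z) ^t* = Pi z)
  (Pi_idem : forall z, Pi z *m Pi z = Pi z)
  (Pi_comm : forall z, commutant U (Pi z)) (Pi_sum : \sum_z Pi z = 1%:M).
Variables (Ix : Type) (Q : Ix -> 'M[C]_n).
Hypotheses (Q_density : forall i, density (Q i))
  (Q_comm : forall i, commutant U (Q i)).

Let Pi_psd z : psd (Pi z).
Proof. exact: (psd_projection (Pi_herm z) (Pi_idem z)). Qed.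

Let p i z := born (Q i) (Pi z).

Lemma block_label_invariant_povm :
  invariant_povms U (block_label (z0 := z0) Pi).
Proof.
split; first exact: block_label_povm.
by move=> g B _; apply/commutant_invariant/commutant_sum => z _; exact: Pi_comm.
Qed.

(** By linearity in the state, the law of [N] is the mixture, with weights [p i z], of its laws in
    the states [tau z]; this mixture is the integral of a kernel against the block-label law. *)
Lemma block_diagonal_sufficient (tau : Z -> 'M[C]_n) :
  (forall z, density (tau z)) ->
  (forall i, Q i = \sum_z (p i z)%:C *: tau z) ->
  qc_sufficient Q (invariant_povms U) (block_label (z0 := z0) Pi).
Proof.
move=> tau_density QE; split; first exact: block_label_invariant_povm.
move=> d Y N [N_povm _].
have /choice[P PE] : forall z, exists P : probability Y R,
    forall B, measurable B -> P B = (born (tau z) (N B))%:E.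
  move=> z; have [tau_psd tau_tr] := tau_density z.
  exact: (povm_law_exists tau_psd N_povm tau_tr).
have [K KE] := discrete_kernel_exists (z0 := z0) P; exists K => i B mB.
rewrite (integral_block_label (Q_density i).1 Pi_psd)// /outcome_law.
rewrite [in LHS]QE born_suml -sumEFin; apply: eq_bigr => z _.
by rewrite KE PE.
Qed.

Hypothesis sufficient :
  qc_sufficient Q (invariant_povms U) (block_label (z0 := z0) Pi).

Definition block_represents (E : 'M[C]_n) (a : Z -> R) : Prop :=
  forall i, born (Q i) E = \sum_z p i z * a z.

(** The weight [a z] is the probability that the simulating kernel assigns to the outcome [true],
    which stands for [E], from the label [z]. *)
Lemma effect_block_represented (E : 'M[C]_n) : invariant_effect E ->
  exists2 a, block_represents E a & forall z, 0 <= a z.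
Proof.
move=> [EU E0 E1]; pose PE (b : bool) := if b then E else 1%:M - E.
have PE_psd b : psd (PE b) by case: b; [exact: E0|exact: E1].
have PE_sum : \sum_b PE b = 1%:M.
  by rewrite big_bool /= addrC subrK.
have PE_comm b : commutant U (PE b).
  by case: b => //; apply: commutantB => //; exact: commutant1.
have N_inv : invariant_povms U (block_label (z0 := true) PE).
  split; first exact: block_label_povm.
  by move=> g B _; apply/commutant_invariant/commutant_sum => b _.
have [_ /(_ _ _ _ N_inv)[K KE]] := sufficient.
pose Y1 : set (discrete_outcomes true) := [set true].
(* Taking [fine] loses nothing, since [K z] is a probability. *)
have K_fin z : (K z Y1 = (fine (K z Y1))%:E)%E.
  apply/esym/fineK; rewrite ge0_fin_numE//.
  rewrite (@le_lt_trans _ _ (K z setT))// ?le_measure ?inE//.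
  by rewrite prob_kernel ltry.
exists (fun z => fine (K z Y1)); last by move=> z; exact: fine_ge0.
move=> i; apply: EFin_inj; have := KE i Y1 I.
rewrite (integral_block_label (Q_density i).1 Pi_psd)// /outcome_law.
rewrite block_label1 => ->.
by rewrite -sumEFin; apply: eq_bigr => z _; rewrite [in LHS]K_fin.
Qed.

Hypothesis separating : forall a : Z -> R,
  (forall i, \sum_z p i z * a z = 0) -> forall z, a z = 0.

(** [T] is chosen before [E] and [a], and serves every representing [a]. Later uses can thus pick a
    convenient one: kernel weights for positivity, the constant 1 for the trace, an indicator for
    the support. *)
Lemma dual_block_operator z : exists T, commutant U T /\
  forall E a, invariant_effect E -> block_represents E a ->
    \tr (T *m E) = (a z)%:C.
Proof.
pose pv i : 'rV[R]_#|Z| := \row_j p i (enum_val j).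
(* [S] is stable under real combinations, and [Q i] is a witness at [pv i] by definition of
   [block_represents]; [enum_val] converts row indices to labels. *)
pose S (v : 'rV[R]_#|Z|) := exists2 T, commutant U T &
  forall E a, invariant_effect E -> block_represents E a ->
    \tr (T *m E) = (\sum_j v 0 j * a (enum_val j))%:C.
have S_all : forall v, S v.
  apply: (separating_family_ind (p := pv)).
  - exists 0; first exact: commutant0.
    move=> E a _ _; rewrite mul0mx mxtrace0 big1// => j _.
    by rewrite mxE mul0r.
  - move=> k u v [T TU TE] [T' TU' TE']; exists (k%:C *: T + T').
      exact: commutant_scale_add.
    move=> E a E_eff Ea; rewrite mulmxDl mxtraceD -scalemxAl mxtraceZ.
    rewrite (TE _ _ E_eff Ea) (TE' _ _ E_eff Ea) -rmorphM -rmorphD /=.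
    congr (_%:C); rewrite mulr_sumr -big_split; apply: eq_bigr => j _ /=.
    by rewrite !mxE mulrDl mulrA.
  - move=> i; exists (Q i) => // E a [_ E0 _] Ea.
    rewrite -(bornE (Q_density i).1 E0) Ea; congr (_%:C).
    rewrite (reindex (@enum_val Z Z)); last first.
      exact: (onW_bij _ (@enum_val_bij Z)).
    by apply: eq_bigr => j _; rewrite mxE.
  - move=> a a0; apply/colP => j; rewrite mxE.
    rewrite -[j]enum_valK.
    apply: (separating (a := fun z => a (enum_rank z) 0)) => i.
    transitivity ((pv i *m a) 0 0); last by rewrite a0 mxE.
    rewrite mxE.
    rewrite (reindex (@enum_val Z Z)); last first.
      exact: (onW_bij _ (@enum_val_bij Z)).
    by apply: eq_bigr => k _; rewrite mxE enum_valK.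
have [T TU TE] := S_all (delta_mx 0 (enum_rank z)).
exists T; split=> // E a E_eff Ea; rewrite (TE _ _ E_eff Ea); congr (_%:C).
rewrite (bigD1 (enum_rank z))//= big1 => [|j /negPf jz]; last first.
  by rewrite mxE jz mul0r.
by rewrite mxE !eqxx mul1r addr0 enum_rankK.
Qed.

Lemma born_total i : \sum_z p i z = 1.
Proof. by rewrite -born_sumr Pi_sum (born1 (Q_density i).2). Qed.

Lemma sufficient_block_diagonal : exists tau : Z -> 'M[C]_n,
  [/\ forall z, density (tau z), forall z, Pi z *m tau z = tau z
    & forall i, Q i = \sum_z (p i z)%:C *: tau z].
Proof.
have /choice[tau /all_and2[tauU tauE]] := dual_block_operator.
have one_eff : invariant_effect 1%:M.
  split; first exact: commutant1.
    by apply: (psd_projection (P := 1%:M)); rewrite ?mulmx1 ?trmx1 ?map_mx1.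
  by rewrite subrr; exact: psd0.
(* The pairing of [tau z] with an effect is one of its kernel weights, hence nonnegative. *)
have tau_psd z : psd (tau z).
  apply: effect_psd => // E E_eff.
  have [a Ea a0] := effect_block_represented E_eff.
  by rewrite (tauE z _ _ E_eff Ea) ler0c.
(* The identity is represented by the constant 1 because the block probabilities sum to 1. *)
have tau_tr z : \tr (tau z) = 1.
  rewrite -[tau z]mulmx1 (tauE z _ (fun=> 1) one_eff)// => i.
  rewrite (born1 (Q_density i).2) -[LHS](born_total i).
  by apply: eq_bigr => z' _; rewrite mulr1.
exists tau; split=> [z||i]; first by split.
  (* It remains to kill [Pi z' *m tau z] for [z' != z]. By definition of [p], the effect [Pi z'] is
     represented by the indicator of [z'], so its trace against [tau z] is 0, and positivity of
     [tau z] gives the product. *)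
  move=> z; rewrite -[RHS]mul1mx -Pi_sum mulmx_suml (bigD1 z)//= big1 ?addr0//.
  move=> z' zz'; apply: (psd_trace_eq0 (tau_psd z)) => //.
  have [Ph' PP'] := projection_compl (Pi_herm z') (Pi_idem z').
  rewrite (tauE z _ (fun z1 => (z1 == z')%:R)).
  - by rewrite eq_sym (negPf zz').
  - by split=> //; exact: (psd_projection Ph' PP').
  move=> i; rewrite (bigD1 z')//= eqxx mulr1 big1 ?addr0// => z1 /negPf ->.
  by rewrite mulr0.
(* Both sides commute with the representation, so comparing their traces against invariant effects
   suffices. *)
apply: effect_separating => //.
  by apply: commutant_sum => z _; rewrite -[_ *: _]addr0;
    apply: commutant_scale_add => //; exact: commutant0.
move=> E E_eff; have [a Ea _] := effect_block_represented E_eff.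
have [_ E0 _] := E_eff.
rewrite -(bornE (Q_density i).1 E0) Ea mulmx_suml mxtrace_sum rmorph_sum /=.
apply: eq_bigr => z _.
by rewrite -scalemxAl mxtraceZ (tauE z _ _ E_eff Ea) rmorphM.
Qed.

End BlockSufficiency.

(** * From block subspaces to projections, and the equivalence *)

(** On a vector split along the blocks, [Pi z] fixes the component in [H z] and kills the others,
    the squared norm of [Pi z' *m v] being the inner product of [v] with a vector of [H z']. *)
Lemma orthogonal_projection_sum (R : realType) (n : nat) (Z : finType)
    (H : Z -> {vspace 'cV[R[i]]_n}) (Pi : Z -> 'M[R[i]]_n) :
  orthogonal_decomposition H ->
  (forall z, orthogonal_projection (H z) (Pi z)) -> \sum_z Pi z = 1%:M.
Proof.
move=> [_ H_orth H_full] Pi_proj.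
have Pi_id z v : v \in H z -> Pi z *m v = v.
  by have [_ _ ->] := Pi_proj z => /eqP.
have Pi_orth z z' v : z != z' -> v \in H z -> Pi z' *m v = 0.
  move=> zz' Hv; have [Ph PP HP] := Pi_proj z'; apply: trace_gram_eq0.
  rewrite trmxC_mul Ph -mulmxA (mulmxA (Pi z')) PP trace_mx11.
  by apply: (H_orth z z') => //; rewrite HP mulmxA PP.
apply/trmx_inj/row_matrixP => j; apply: trmx_inj; rewrite !tr_row !trmxK.
rewrite !colE mul1mx; set v := delta_mx j 0.
have /memv_sumP[u uH ->] : v \in (\sum_z H z)%VS by rewrite H_full memvf.
rewrite mulmx_suml; apply: eq_bigr => z _.
rewrite mulmx_sumr (bigD1 z)//= Pi_id ?uH// big1 ?addr0// => z' zz'.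
by rewrite (Pi_orth z')// uH.
Qed.

Theorem corollary4p5 (R : realType)
    (G : topGroupType) (compactG : compact [set: G])
    (hausdorffG : hausdorff_space G)
    (mu : probability (borel G) R) (haar_mu : normalized_haar mu)
    (d : measure_display) (Theta : measurableType d)
    (act : measurable_action G Theta)
    (n : nat) (U : G -> 'M[R[i]]_n) (repU : unitary_rep U)
    (rho : Theta -> 'M[R[i]]_n) (covariant_rho : covariant_family act U rho)
    (Z : finType) (z0 : Z) (H : Z -> {vspace 'cV[R[i]]_n})
    (decH : orthogonal_decomposition H)
    (Pi : Z -> 'M[R[i]]_n)
    (projPi : forall z, orthogonal_projection (H z) (Pi z))
    (centralPi : forall z, central_in (commutant U) (Pi z)) :
  let rhobar : orbit_space act -> 'M[R[i]]_n := orbit_average mu U rho in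
  let p (eta : orbit_space act) (z : Z) : R := born (rhobar eta) (Pi z) in
  (forall a : Z -> R,
     (forall eta, \sum_(z : Z) p eta z * a z = 0) -> forall z, a z = 0) ->
  ((exists tau : Z -> 'M[R[i]]_n,
      (forall z, density_on (H z) (tau z)) /\
      (forall eta, rhobar eta = \sum_(z : Z) (p eta z)%:C *: tau z))
   <->
   qc_sufficient rhobar (invariant_povms U) (block_label (z0 := z0) Pi)).
Proof.
move=> rhobar p separating.
have [rho_density _] := covariant_rho.
have Pi_sum := orthogonal_projection_sum decH projPi.
have Pi_herm z : ((Pi z) ^t* = Pi z)%sesqui by have [] := projPi z.
have Pi_idem z : Pi z *m Pi z = Pi z by have [] := projPi z.
have Pi_comm z : commutant U (Pi z) by have [] := centralPi z.
(* [rhobar eta] unfolds to [haar_average mu U (rho (repr eta))], which inherits positivity and trace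
   from [rho (repr eta)]. *)
have Q_density eta : density (rhobar eta).
  have [rho_psd rho_tr] := rho_density (repr eta); split.
    exact: (haar_average_psd compactG mu repU rho_psd).
  by rewrite -rho_tr; exact: (haar_average_trace compactG mu repU).
have Q_comm eta : commutant U (rhobar eta).
  exact: (haar_average_commutant compactG haar_mu repU).
split=> [[tau [tau_density QE]]|sufficient].
  apply: (block_diagonal_sufficient repU z0 Pi_herm Pi_idem Pi_comm Pi_sum
    Q_density (tau := tau)) => // z.
  by have [] := tau_density z.
have [tau [tau_density tau_range QE]] := sufficient_block_diagonal compactG
  haar_mu repU Pi_herm Pi_idem Pi_comm Pi_sum Q_density Q_comm sufficient
  separating.
(* Membership in [H z] means being fixed by [Pi z], and [Pi z *m tau z = tau z] gives this for the
   whole range. *)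
exists tau; split=> // z; split=> // v.
by have [_ _ ->] := projPi z; rewrite mulmxA tau_range.
Qed.
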